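(* Let $n\ge 2$, let $G\le S_n$ be a subgroup, and let $\lambda,\mu$ be integer partitions of $n$. Let $P$ and $Q$ be ordered set partitions of $\{1,\dots,n\}$ of shapes $\lambda$ and $\mu$ respectively, let $S_\lambda$ be the set of left cosets of the Young subgroup $Y_P$ in $S_n$, and let $S_\mu$ be the set of left cosets of the Young subgroup $Y_Q$ in $S_n$, with $G$ acting on both sets by left multiplication. If $\lambda\unlhd\mu$, then $$\operatorname{orb}(G,S_\lambda)\ \ge\ \operatorname{orb}(G,S_\mu).$$
   Context: $\Omega=\{1,\dots,n\}$ and $S_n=\mathrm{Sym}(\Omega)$. An integer partition of $n$ is a weakly decreasing sequence $\lambda=(\lambda_1\ge\dots\ge\lambda_k)$ of positive integers with sum $n$. An ordered set partition of $\Omega$ is a tuple $P=(P_1,\dots,P_k)$ of pairwise disjoint non-empty subsets with union $\Omega$, with $|P_1|\ge\dots\ge|P_k|$; its shape is $(|P_1|,\dots,|P_k|)$. The Young subgroup $Y_P\le S_n$ consists of all permutations fixing each $P_i$ setwise. Dominance order: $\lambda\unlhd\mu$ iff $\sum_{i=1}^j\lambda_i\le\sum_{i=1}^j\mu_i$ for all $j$ (parts beyond the length of a partition are taken to be $0$). $\operatorname{orb}(G,S)$ is the number of orbits of $G$ acting on $S$. *)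

(* Defs.v *)
From mathcomp Require Import all_boot all_fingroup.

Set Implicit Arguments.
Unset Strict Implicit.
Unset Printing Implicit Defensive.

Import GroupScope.

(* The set {1, ..., n} is represented by 'I_n = {0, ..., n-1}. *)

Definition is_intpart (n : nat) (la : seq nat) : Prop :=
  [/\ sorted geq la, all (fun a => 0 < a) la & sumn la = n].

(* [take j] returns the whole sequence once j exceeds its length, which is the
   convention that the missing parts are 0. *)
Definition dominated (la mu : seq nat) : Prop :=
  forall j : nat, sumn (take j la) <= sumn (take j mu).

Definition part_sizes (n : nat) (P : seq {set 'I_n}) : seq nat :=
  [seq #|B| | B : {set 'I_n} <- P].

Definition ordered_set_partition (n : nat) (P : seq {set 'I_n}) : Prop :=
  [/\ pairwise (fun A B : {set 'I_n} => [disjoint A & B]) P,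
      all (fun B : {set 'I_n} => B != set0) P,
      \bigcup_(B <- P) B = [set: 'I_n]
    & sorted geq (part_sizes P)].

Definition young_subgroup (n : nat) (P : seq {set 'I_n}) : {group 'S_n} :=
  [group of \bigcap_(B in P) 'N(B | 'P)].

Lemma young_subgroupP (n : nat) (P : seq {set 'I_n}) (s : 'S_n) :
  reflect (forall B, B \in P -> s @: B = B) (s \in young_subgroup P).
Proof.
apply: (iffP bigcapP) => sP B /sP; first by move/astabs_setact.
by move=> sB; rewrite -astab1_set; apply/astab1P.
Qed.

(* Left multiplication (g, A) |-> g *: A is a left action, whereas [action]
   is the structure of right actions; g is therefore inverted, which does not
   change the orbits (see [orbit_lmul]). *)
Definition lmul (gT : finGroupType) (A : {set gT}) (g : gT) : {set gT} :=
  g^-1 *: A.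

Lemma lmul_is_action (gT : finGroupType) : is_action [set: gT] (@lmul gT).
Proof.
split=> [g A B /lcoset_inj // | A g h _ _].
by rewrite /lmul invMg lcosetM.
Qed.

Canonical lmul_action (gT : finGroupType) := Action (@lmul_is_action gT).

Lemma orbit_lmul (gT : finGroupType) (G : {group gT}) (A : {set gT}) :
  orbit (lmul_action gT) G A = [set g *: A | g in G].
Proof.
apply/setP=> B; apply/imsetP/imsetP=> -[g Gg ->];
  by exists g^-1; rewrite ?groupV //= /lmul ?invgK.
Qed.

Definition orb (gT : finGroupType) (D : {set gT}) (T : finType)
    (to : action D T) (G : {set gT}) (S : {set T}) : nat :=
  #|orbit to G @: S|.

(* The product of 'S_n is (s * t) x = t (s x).  For the opposite convention the
   left cosets below become right cosets under right multiplication; since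
   inversion exchanges the two actions, the numbers of orbits are the same. *)
Definition young_cosets (n : nat) (P : seq {set 'I_n}) : {set {set 'S_n}} :=
  lcosets (young_subgroup P) [set: 'S_n].

(* Main.v *)
Require Import Defs.
From mathcomp Require Import all_boot all_fingroup.
From mathcomp Require Import all_order all_algebra zify.

Set Implicit Arguments.
Unset Strict Implicit.
Unset Printing Implicit Defensive.

Import Order.TTheory GRing.Theory Num.Theory.

(** Let [P] be an ordered set partition of shape [la].  A left coset of its
    Young subgroup is the same thing as a colouring of the points in which the
    colour [k] is used [la_k] times: colour the points by the blocks of [P] and
    let the permutations move this colouring around ([orb_young_cosets]).  So
    the theorem compares the numbers of [G]-orbits on colourings of two given
    contents.

    The content [mu] can be turned into the dominated content [la] by moving
    units one at a time from a colour [i] to a colour [j] that is used less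
    often than [i] ([dominance_move]).  It is enough that one such move does not
    decrease the number of orbits ([leq_orb_move]).

    For one move, let [transfer i j] be the linear map on rational functions of
    colourings whose value at [d] is the sum of the values at the colourings
    obtained from [d] by turning one point of colour [j] into colour [i].  It
    commutes with all permutations of the points and takes functions supported
    on the content before the move to functions supported on the content after
    it.  If it is injective there, then so is its restriction to the
    [G]-invariant functions, and the dimension of the space of [G]-invariant
    functions is the number of orbits ([leq_orb_injective_kernel]).

    Injectivity is the sl_2 argument.  With E = [transfer i j] and
    F = [transfer j i], the two maps are adjoint ([transfer_adjoint]) and
    FE - EF multiplies by the number of points of colour [i] minus the number
    of points of colour [j] ([transfer_commutator]).  Hence, for [f] supported
    on a content [a], |E f|^2 = |F f|^2 + (a_i - a_j) |f|^2, and E f = 0 forces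
    f = 0 as soon as a_i > a_j ([transfer_injective]). *)

(** * Comparing numbers of orbits *)

(** The kernel [W] is an invariant matrix, so it maps [G]-invariant functions on
    [S1] to [G]-invariant functions on [S2].  In terms of the bases of orbit
    indicators this is the matrix [M] of the proof, with one row for each orbit
    on [S1] and one column for each orbit on [S2]; injectivity makes its rows
    independent. *)
Lemma leq_orb_injective_kernel (gT : finGroupType) (G : {group gT}) (T1 T2 : finType)
    (to1 : {action gT &-> T1}) (to2 : {action gT &-> T2})
    (S1 : {set T1}) (S2 : {set T2}) (W : T1 -> T2 -> rat) :
  [acts G, on S1 | to1] ->
  (forall g x y, g \in G -> W (to1 x g) (to2 y g) = W x y) ->
  (forall f : T1 -> rat,
     {in S2, forall y, \sum_(x in S1) f x * W x y = 0}%R ->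
     {in S1, forall x, f x = 0}%R) ->
  orb to1 G S1 <= orb to2 G S2.
Proof.
move=> actS1 Winv Winj; rewrite /orb.
set O1 := _ @: S1; set O2 := _ @: S2.
have /fin_all_exists2 [x xS1 xO] (i : 'I_#|O1|) :
    exists2 x, x \in S1 & enum_val i = orbit to1 G x.
  by have /imsetP[x] := enum_valP i; exists x.
have /fin_all_exists2 [y yS2 yO] (j : 'I_#|O2|) :
    exists2 y, y \in S2 & enum_val j = orbit to2 G y.
  by have /imsetP[y] := enum_valP j; exists y.
pose f (v : 'rV[rat]_#|O1|) z :=
  (\sum_i v ord0 i * (z \in orbit to1 G (x i))%:R)%R.
have f_orbit v i : f v (x i) = v ord0 i.
  rewrite /f (bigD1 i) //= orbit_refl mulr1 big1 ?addr0 // => k neq_ki.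
  rewrite -orbit_eq_mem -!xO (inj_eq enum_val_inj) eq_sym (negbTE neq_ki).
  by rewrite mulr0.
have f_inv v z g : g \in G -> f v (to1 z g) = f v z.
  move=> Gg; apply: eq_bigr => i _.
  by rewrite -!orbit_eq_mem (orbit_eqP (mem_orbit to1 z Gg)).
pose M := (\matrix_(i < #|O1|, j < #|O2|)
  \sum_(z in S1 | z \in orbit to1 G (x i)) W z (y j))%R.
suff /eqP <- : row_free M by apply: rank_leq_col.
apply: inj_row_free => v vM0.
have fW0 : {in S2, forall u, \sum_(z in S1) f v z * W z u = 0}%R.
  move=> u uS2.
  have /imsetP[j0 _ Ej0] : orbit to2 G u \in enum_val @: [set: 'I_#|O2|].
    apply/imsetP; exists (enum_rank_in (imset_f (orbit to2 G) uS2) (orbit to2 G u)) => //.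
    by rewrite enum_rankK_in ?imset_f.
  move: Ej0; rewrite yO => /eqP; rewrite orbit_eq_mem => /orbitP[g Gg <-].
  (* The value at [u] equals the value at the representative [y j0] of its
     orbit, where it is an entry of [v *m M]. *)
  rewrite (reindex_inj (act_inj to1 g)) /=.
  have := congr1 (fun A : 'rV_ _ => A ord0 j0) vM0; rewrite !mxE => {2}<-.
  rewrite (eq_bigl [pred z in S1]); last first.
    by move=> z; rewrite /= (actsP actS1).
  under eq_bigr => z _ do rewrite f_inv // Winv // mulr_suml.
  rewrite exchange_big /=; apply: eq_bigr => i _.
  rewrite mxE mulr_sumr big_mkcondr /=; apply: eq_bigr => z _.
  by case: ifP => _; rewrite ?mulr1 ?mulr0 ?mul0r.
apply/rowP=> i; rewrite mxE -f_orbit.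
by apply: Winj fW0 _ (xS1 i).
Qed.

Lemma orb_imset (gT : finGroupType) (G : {group gT}) (T1 T2 : finType)
    (to1 : {action gT &-> T1}) (to2 : {action gT &-> T2}) (S : {set T1})
    (phi : T1 -> T2) :
  [acts G, on S | to1] -> {in S &, injective phi} ->
  (forall x g, g \in G -> phi (to1 x g) = to2 (phi x) g) ->
  orb to2 G (phi @: S) = orb to1 G S.
Proof.
move=> actS phi_inj phi_act; rewrite /orb -imset_comp.
have phi_orbit x : orbit to2 G (phi x) = phi @: orbit to1 G x.
  rewrite /orbit -imset_comp; apply: eq_in_imset => g Gg /=.
  by rewrite phi_act.
rewrite (eq_imset _ phi_orbit) (imset_comp (fun A : {set T1} => phi @: A)).
rewrite card_in_imset // => _ _ /imsetP[x xS ->] /imsetP[y yS ->] eq_xy.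
have : phi x \in phi @: orbit to1 G y by rewrite -eq_xy imset_f ?orbit_refl.
case/imsetP=> z zy /phi_inj xz; apply/eqP; rewrite orbit_eq_mem xz //.
by apply: subsetP zy; rewrite acts_sub_orbit.
Qed.

(** * Colourings and the transfer operators *)

Section Colourings.

Variables (X K : finType).
Implicit Types (c d : {ffun X -> K}) (x y : X) (i j k : K).

Definition recolour c x k : {ffun X -> K} :=
  [ffun y => if y == x then k else c y].

Definition mult c k : nat := #|[pred x | c x == k]|.

Definition colourings (a : K -> nat) : {set {ffun X -> K}} :=
  [set c | [forall k, mult c k == a k]].

Lemma colouringsP a c : reflect (mult c =1 a) (c \in colourings a).
Proof. by rewrite inE; apply: (iffP forallP) => H k; apply/eqP. Qed.

Lemma eq_colourings a b : a =1 b -> colourings a = colourings b.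
Proof.
move=> ab; apply/setP=> c.
by apply/colouringsP/colouringsP => H k; rewrite H ab.
Qed.

Lemma multE c k : mult c k = \sum_x (c x == k).
Proof. by rewrite /mult -sum1_card big_mkcond. Qed.

(** Both sides are the content of [c] plus one unit at [i]; the additive form
    avoids truncated subtraction and covers the case [i = j]. *)
Lemma mult_recolour c x i j k : c x = j ->
  mult c k + (k == i) = mult (recolour c x i) k + (k == j).
Proof.
move=> cx; rewrite !multE !(bigD1 (P := xpredT) x) //= ffunE eqxx cx.
rewrite [in RHS](eq_bigr (fun y => nat_of_bool (c y == k))); last first.
  by move=> y /negbTE neq_yx; rewrite ffunE neq_yx.
by rewrite (eq_sym j) (eq_sym i); lia.
Qed.

Lemma recolour_id c x k : c x = k -> recolour c x k = c.
Proof.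
by move=> cx; apply/ffunP=> y; rewrite ffunE; case: eqP => // ->.
Qed.

Lemma recolour_idem c x i j : recolour (recolour c x i) x j = recolour c x j.
Proof. by apply/ffunP=> y; rewrite !ffunE; case: eqP. Qed.

Lemma recolourC c x y i j : x != y ->
  recolour (recolour c x i) y j = recolour (recolour c y j) x i.
Proof.
move=> neq_xy; apply/ffunP=> z; rewrite !ffunE.
by case: eqP => // ->; rewrite eq_sym (negbTE neq_xy).
Qed.

Local Open Scope ring_scope.

Definition transfer i j (f : {ffun X -> K} -> rat) d : rat :=
  \sum_(x | d x == j) f (recolour d x i).

(** Both sides sum over the pairs of colourings that differ at one point [x],
    coloured [i] in the one and [j] in the other. *)
Lemma transfer_adjoint i j f g :
  \sum_d transfer i j f d * g d = \sum_c f c * transfer j i g c.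
Proof.
rewrite /transfer.
under eq_bigr do rewrite mulr_suml big_mkcond.
under [RHS]eq_bigr do rewrite mulr_sumr big_mkcond.
rewrite exchange_big [RHS]exchange_big /=; apply: eq_bigr => x _.
rewrite -!big_mkcond /=.
rewrite (reindex_onto (fun c => recolour c x j) (fun c => recolour c x i)).
  apply: eq_big => [c | c /andP[_ /eqP->] //].
  rewrite ffunE !eqxx recolour_idem /=.
  apply/eqP/eqP => [<- | /recolour_id //]; by rewrite ffunE eqxx.
by move=> c /eqP cx; rewrite recolour_idem recolour_id.
Qed.

(** Recolouring a point [x] and then a different point [y] can be done in either
    order, so these terms cancel.  The terms where the same point is recoloured
    twice restore [c], once for each point of colour [i] in the first product
    and once for each point of colour [j] in the second. *)
Lemma transfer_commutator i j f c : i != j ->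
  transfer j i (transfer i j f) c =
  transfer i j (transfer j i f) c + ((mult c i)%:R - (mult c j)%:R) * f c.
Proof.
(* The diagonal terms, in which the second recolouring undoes the first, are
   split off; the remaining double sum is symmetric in [k] and [l]. *)
have transfer2 k l : k != l -> transfer l k (transfer k l f) c =
    (mult c k)%:R * f c +
    \sum_(x | c x == k) \sum_(y | c y == l) f (recolour (recolour c x l) y k).
  move=> neq_kl; rewrite mulr_natl /mult -sumr_const -big_split /=.
  apply: eq_bigr => x /eqP cx.
  rewrite /transfer (bigD1 x) ?ffunE ?eqxx //=.
  rewrite recolour_idem recolour_id //; congr (_ + _); apply: eq_bigl => y.
  rewrite ffunE; case: (eqVneq y x) => [-> | _]; last by rewrite andbT.
  by rewrite andbF cx (negbTE neq_kl).
move=> neq_ij; rewrite !transfer2 // 1?eq_sym // [in RHS]exchange_big /=.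
rewrite addrAC -mulrDl addrC subrKC addrC; congr (_ + _).
apply: eq_bigr => x /eqP cx; apply: eq_bigr => y /eqP cy.
by rewrite recolourC //; apply: contraNneq neq_ij => xy; rewrite -cx -cy xy.
Qed.

(** With E = [transfer i j] and F = [transfer j i], adjunction and the commutator
    give |E f|^2 = |F f|^2 + (a_i - a_j) |f|^2.  The left side is 0 and both
    terms on the right are nonnegative. *)
Lemma transfer_injective a i j f : (a j < a i)%N ->
    (forall c, c \notin colourings a -> f c = 0) ->
  (forall d, transfer i j f d = 0) -> forall c, f c = 0.
Proof.
move=> a_ji f_supp f0.
have neq_ij : i != j by apply: contraTneq a_ji => ->; rewrite ltnn.
have sum0 : \sum_d transfer i j f d * transfer i j f d = 0.
  by apply: big1 => d _; rewrite f0 mul0r.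
have comm c : f c * transfer j i (transfer i j f) c =
    f c * transfer i j (transfer j i f) c + ((a i)%:R - (a j)%:R) * (f c * f c).
  rewrite transfer_commutator // mulrDr; congr (_ + _).
  have [/colouringsP ca | /f_supp ->] := boolP (c \in colourings a).
    by rewrite !ca mulrCA.
  by rewrite !(mul0r, mulr0).
move: sum0; rewrite transfer_adjoint (eq_bigr _ (fun c _ => comm c)).
rewrite big_split /= -transfer_adjoint -mulr_sumr => /eqP.
have sq_ge0 g : 0 <= \sum_(c : {ffun X -> K}) g c * g c :> rat.
  by apply: sumr_ge0 => c _; rewrite -expr2 sqr_ge0.
have a_gt0 : 0 < (a i)%:R - (a j)%:R :> rat by rewrite subr_gt0 ltr_nat.
rewrite paddr_eq0 //; last by rewrite mulr_ge0 // ltW.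
rewrite mulf_eq0 (gt_eqF a_gt0) /=.
case/andP=> _; rewrite psumr_eq0 => [/allP f20 c | c _]; last first.
  by rewrite -expr2 sqr_ge0.
by have := f20 c (mem_index_enum _); rewrite mulf_eq0 orbb => /eqP.
Qed.

Local Close Scope ring_scope.

(** The inverse makes this a right action, as the structure [action] requires. *)
Definition colact c (g : {perm X}) : {ffun X -> K} :=
  [ffun x => c (g^-1%g x)].

Lemma colact_is_action : is_action [set: {perm X}] colact.
Proof.
apply: is_total_action => [c | c g h]; apply/ffunP=> x.
  by rewrite ffunE invg1 perm1.
by rewrite !ffunE invMg permM.
Qed.

Canonical colact_action := Action colact_is_action.

Lemma mult_colact c g k : mult (colact c g) k = mult c k.
Proof.
rewrite !multE (reindex_inj (@perm_inj _ g)).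
by apply: eq_bigr => x _; rewrite ffunE permK.
Qed.

Lemma acts_colourings (G : {group {perm X}}) a :
  [acts G, on colourings a | colact_action].
Proof.
apply/actsP=> g _ c; apply/colouringsP/colouringsP => H k;
  by rewrite -H mult_colact.
Qed.

Lemma recolour_colact c g x k :
  recolour (colact c g) (g x) k = colact (recolour c x k) g.
Proof.
by apply/ffunP=> y; rewrite !ffunE (can2_eq (permKV g) (permK g)).
Qed.

(** The content [b] arises from [a] by moving one unit from [i] to [j].  For
    functions supported on [colourings a], the kernel [W] below computes
    [transfer i j]. *)
Lemma leq_orb_move (G : {group {perm X}}) (a b : K -> nat) i j :
    a j < a i -> (forall k, b k + (k == i) = a k + (k == j)) ->
  orb colact_action G (colourings a) <= orb colact_action G (colourings b).
Proof.
move=> a_ji ab.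
pose W c d : rat := (\sum_(x | d x == j) (c == recolour d x i)%:R)%R.
apply: (@leq_orb_injective_kernel _ _ _ _ _ _ _ _ W); first exact: acts_colourings.
  move=> g c d _; rewrite /W (reindex_inj (@perm_inj _ g)) /=.
  apply: eq_big => [x | x _]; first by rewrite ffunE permK.
  by rewrite recolour_colact (inj_eq (act_inj colact_action g)).
move=> f f0 c ca.
(* Extended by 0, [f] satisfies the support condition of the injectivity lemma;
   its transfer vanishes outside [colourings b] by counting colours. *)
pose fa c := (if c \in colourings a then f c else 0)%R.
suff : fa c = 0%R by rewrite /fa ca.
apply: (transfer_injective a_ji) => {c ca} [c /negbTE | d].
  by rewrite /fa => ->.
have [db | ndb] := boolP (d \in colourings b).
  rewrite -[RHS](f0 d db) /W; under [RHS]eq_bigr do rewrite mulr_sumr.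
  rewrite exchange_big; apply: eq_bigr => x _.
  rewrite /fa /= big_mkcond (bigD1 (recolour d x i)) //= eqxx.
  rewrite mulr1 big1 ?addr0 // => c /negbTE->.
  by rewrite mulr0 if_same.
apply: big1 => x /eqP dx; rewrite /fa; case: ifP => // /colouringsP da.
case/negP: ndb; apply/colouringsP=> k.
by apply/eqP; rewrite -(eqn_add2r (k == i)) ab (mult_recolour i k dx) da.
Qed.

End Colourings.

(** * Moving down the dominance order *)

Lemma ltn_sum (I : finType) (Pr : pred I) (F H : I -> nat) i :
    Pr i -> F i < H i -> (forall k, Pr k -> F k <= H k) ->
  \sum_(k | Pr k) F k < \sum_(k | Pr k) H k.
Proof.
move=> Pi ltFH leFH; rewrite (bigD1 i) //= [ltnRHS](bigD1 i) //= -addSn.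
by rewrite leq_add // leq_sum // => k /andP[/leFH].
Qed.

(** Take for [j] the first index with [b j < a j].  The partial sums up to [j]
    force some earlier [i] with [a i < b i].  Before [j] every term of [b] is
    at least the term of [a], so the partial sums that contain [i] but not [j]
    are strictly larger for [b]: moving a unit of [b] from [i] to [j] preserves
    dominance, which is the last clause.  Such a move can destroy monotonicity,
    so for the moves to be iterated [b] has to be an arbitrary content. *)
Lemma dominance_move N (a b : 'I_N -> nat) :
    {homo a : i j / i <= j >-> j <= i} ->
    (forall m, \sum_(k < N | k < m) a k <= \sum_(k < N | k < m) b k) ->
    \sum_k a k = \sum_k b k ->
  a =1 b \/ exists i j : 'I_N, [/\ a i < b i, b j < a j, a j <= a i &
    forall m, \sum_(k < N | k < m) a k + (i < m)
           <= \sum_(k < N | k < m) b k + (j < m)].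
Proof.
move=> a_decr dom eq_sum; have [j0 lt_j0 | le_ab] := pickP (fun j => b j < a j).
  right; case: (@arg_minnP _ j0 (fun j => b j < a j) val lt_j0) => j lt_j j_min.
  have le_ab (k : 'I_N) : k < j -> a k <= b k.
    by move=> lt_kj; rewrite leqNgt; apply: contraL lt_kj => /j_min; rewrite -leqNgt.
  have [i /andP[lt_ij lt_i] | none] := pickP (fun i : 'I_N => (i < j) && (a i < b i)).
    exists i, j; split=> // [|m]; first exact/a_decr/ltnW.
    case: (ltnP i m) => lt_im; last by rewrite addn0 (leq_trans (dom m)) ?leq_addr.
    case: (ltnP j m) => [_ | le_mj]; first by rewrite leq_add2r.
    rewrite addn0 addn1; apply: ltn_sum lt_im lt_i _ => k lt_km.
    exact/le_ab/leq_trans/le_mj.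
  have := dom j.+1; rewrite leqNgt => /negP[].
  apply: (ltn_sum (ltnSn j) lt_j) => k.
  rewrite ltnS leq_eqVlt => /predU1P[/val_inj-> | lt_kj]; first exact: ltnW lt_j.
  by move/negbT: (none k); rewrite lt_kj /= -leqNgt.
have {}le_ab k : a k <= b k by rewrite leqNgt le_ab.
left=> i; apply/eqP; rewrite eqn_leq le_ab leqNgt; apply/negP=> lt_i.
have := ltn_sum (Pr := xpredT) isT lt_i (fun k _ => le_ab k).
by rewrite eq_sum ltnn.
Qed.

(** Induction on the total excess of [b] over [a], which each move of
    [dominance_move] decreases.  Such a move goes from [i] to [j] with
    [b j < a j <= a i < b i], as [leq_orb_move] requires. *)
Lemma leq_orb_dominance (X : finType) N (G : {group {perm X}})
    (a b : 'I_N -> nat) :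
    {homo a : i j / i <= j >-> j <= i} ->
    (forall m, \sum_(k < N | k < m) a k <= \sum_(k < N | k < m) b k) ->
    \sum_k a k = \sum_k b k ->
  orb (colact_action X 'I_N) G (colourings X b) <=
  orb (colact_action X 'I_N) G (colourings X a).
Proof.
move=> a_decr; have [e] := ubnP (\sum_k (b k - a k)).
elim: e b => // e IH b lt_e dom eq_sum.
have [eq_ab | [i [j [lt_i lt_j le_ji domD]]]] := dominance_move a_decr dom eq_sum.
  by rewrite (eq_colourings X eq_ab).
have neq_ij : i != j by apply: contraTneq lt_i => ->; rewrite -leqNgt ltnW.
pose b' k := if k == i then (b k).-1 else if k == j then (b k).+1 else b k.
have b'E k : b' k + (k == i) = b k + (k == j).
  rewrite /b'; case: (eqVneq k i) => [-> | _].
    by rewrite (negbTE neq_ij); lia.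
  by case: eqP => _; lia.
have sum1 (m : nat) (i0 : 'I_N) : \sum_(k < N | k < m) (k == i0) = (i0 < m).
  rewrite big_mkcond (bigD1 i0) //= eqxx big1 ?addn0; first by case: ltnP.
  by move=> k /negbTE->; case: ifP.
have sumb' m : \sum_(k < N | k < m) b' k + (i < m) = \sum_(k < N | k < m) b k + (j < m).
  by rewrite -!sum1 -!big_split; apply: eq_bigr => k _; apply: b'E.
have sumN (F : 'I_N -> nat) : \sum_k F k = \sum_(k < N | k < N) F k.
  by apply: eq_bigl => k; rewrite ltn_ord.
apply: leq_trans (leq_orb_move G _ b'E) (IH b' _ _ _); first by lia.
- rewrite -ltnS; apply: leq_trans lt_e; rewrite ltnS.
  apply: (@ltn_sum _ _ _ _ i) => // [|k _].
    by rewrite /b' eqxx; lia.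
  have := b'E k; case: (eqVneq k i) => [->|_]; first by rewrite (negbTE neq_ij); lia.
  by case: (eqVneq k j) => [->|_]; lia.
- by move=> m; have := domD m; have := sumb' m; lia.
by have := sumb' N; rewrite eq_sum !sumN !ltn_ord; lia.
Qed.

Lemma sum_nth_take N s m : size s <= N ->
  \sum_(k < N | k < m) nth 0 s k = sumn (take m s).
Proof.
elim: s N m => [|x s IH] N m.
  by move=> _; rewrite big1 // => k _; rewrite nth_nil.
case: N => // N le_sN; case: m => [|m]; first by rewrite big_pred0.
rewrite big_mkcond big_ord_recl /= -(IH N m) // [in RHS]big_mkcond.
by congr (_ + _); apply: eq_bigr.
Qed.

(** * Cosets of Young subgroups as colourings *)

Lemma eq_mult_perm n (K : finType) (c d : {ffun 'I_n -> K}) :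
  mult c =1 mult d -> exists s : 'S_n, forall x, d (s x) = c x.
Proof.
move=> eq_cd.
have countE (e : {ffun 'I_n -> K}) k : count_mem k [tuple e i | i < n] = mult e k.
  by rewrite count_map -sum1_count big_enum_cond sum1_card.
have /tuple_permP[s sE] : perm_eq [tuple c i | i < n] [tuple d i | i < n].
  by apply/allP=> k _ /=; rewrite !countE eq_cd.
exists s => x; have := congr1 (nth (c x) ^~ x) sE.
by rewrite !nth_mktuple tnth_mktuple.
Qed.

Section YoungCosets.

Variables (n N : nat) (P : seq {set 'I_n}).
Hypotheses (hP : ordered_set_partition P) (le_PN : size P <= N.+1).

(** More colours than blocks are allowed, so that two partitions with different
    numbers of blocks can share one set of colours. *)
Definition block_colouring : {ffun 'I_n -> 'I_N.+1} :=
  [ffun x => inord (find (fun B : {set 'I_n} => x \in B) P)].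

Local Notation cP := block_colouring.

(** A colour beyond the number of blocks corresponds to the empty default of
    [nth], and it is indeed never used. *)
Lemma mem_block x (k : 'I_N.+1) : (x \in nth set0 P k) = (cP x == k).
Proof.
case: hP => disjP _ coverP _.
have xP : has (fun B : {set 'I_n} => x \in B) P.
  have : x \in \bigcup_(B <- P) B by rewrite coverP inE.
  by rewrite bigcup_seq => /bigcupP[B BP xB]; apply/hasP; exists B.
have := xP; rewrite has_find => lt_find.
rewrite ffunE -val_eqE /= inordK ?(leq_trans lt_find) //.
have xf := nth_find set0 xP.
apply/idP/eqP => [xk | <- //].
have lt_k : k < size P.
  by rewrite ltnNge; apply: contraL xk => /(nth_default set0)->; rewrite inE.
move/pairwiseP: disjP => /(_ set0) disjP.
set f := find _ P in lt_find xf *; case: (ltngtP f k) => // [lt_fk | lt_kf].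
  by rewrite (disjointFr (disjP _ _ lt_find lt_k lt_fk) xf) in xk.
by rewrite (disjointFr (disjP _ _ lt_k lt_find lt_kf) xk) in xf.
Qed.

Lemma mult_block k : mult cP k = nth 0 (part_sizes P) k.
Proof.
transitivity #|nth set0 P k|.
  by apply: eq_card => x; rewrite mem_block.
have [lt_k | le_k] := ltnP k (size P); first by rewrite (nth_map set0).
by rewrite !nth_default ?cards0 ?size_map.
Qed.

Lemma young_subgroup_colouringP (s : 'S_n) :
  reflect (forall x, cP (s x) = cP x) (s \in young_subgroup P).
Proof.
apply: (iffP (young_subgroupP _ _)) => [sY x | sc B BP].
  have xk : x \in nth set0 P (cP x) by rewrite mem_block.
  apply/eqP; rewrite -mem_block -(sY (nth set0 P (cP x))) ?imset_f ?mem_nth //.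
  by rewrite ltnNge; apply: contraL xk => /(nth_default set0)->; rewrite inE.
pose k : 'I_N.+1 := inord (index B P).
have <- : nth set0 P k = B by rewrite inordK ?nth_index ?(leq_trans _ le_PN) ?index_mem.
apply/eqP; rewrite eqEcard card_imset ?leqnn; last exact: perm_inj.
rewrite andbT; apply/subsetP=> _ /imsetP[x xk ->].
by rewrite mem_block sc -mem_block.
Qed.

(** In the convention [(s * t) x = t (s x)], right factors from the Young subgroup
    act after [s] and preserve block colours, so the fibres of
    [s |-> block_colouring \o s] are left cosets. *)
Definition coset_of_colouring (c : {ffun 'I_n -> 'I_N.+1}) : {set 'S_n} :=
  [set s : 'S_n | [forall x, cP (s x) == c x]].

Lemma coset_of_colouringP (c : {ffun 'I_n -> 'I_N.+1}) (s : 'S_n) :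
  reflect (forall x, cP (s x) = c x) (s \in coset_of_colouring c).
Proof. by rewrite inE; apply: (iffP forallP) => H x; apply/eqP. Qed.

Lemma lcoset_young (s : 'S_n) :
  (s *: young_subgroup P)%g = coset_of_colouring [ffun x => cP (s x)].
Proof.
apply/setP=> t; rewrite mem_lcoset.
apply/young_subgroup_colouringP/coset_of_colouringP => H x.
  by rewrite [RHS]ffunE -(H (s x)) permM permK.
by rewrite permM H [LHS]ffunE permKV.
Qed.

Lemma colouring_transitive c :
  c \in colourings 'I_n (fun k : 'I_N.+1 => nth 0 (part_sizes P) k) ->
  exists s : 'S_n, c = [ffun x => cP (s x)].
Proof.
move/colouringsP=> cP_; have [|s sE] := @eq_mult_perm n _ c cP.
  by move=> k; rewrite cP_ mult_block.
by exists s; apply/ffunP=> x; rewrite ffunE sE.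
Qed.

Lemma orb_young_cosets (G : {group 'S_n}) :
  orb (lmul_action 'S_n) G (young_cosets P) =
  orb (colact_action 'I_n 'I_N.+1) G
    (colourings 'I_n (fun k : 'I_N.+1 => nth 0 (part_sizes P) k)).
Proof.
set S := colourings _ _.
have -> : young_cosets P = coset_of_colouring @: S.
  apply/setP=> C; apply/lcosetsP/imsetP => [[s _ ->] | [c cS ->]].
    exists [ffun x => cP (s x)]; last exact: lcoset_young.
    apply/colouringsP=> k; rewrite -mult_block -(mult_colact cP s^-1%g).
    by apply: eq_card => x; rewrite !inE !ffunE invgK.
  by have [s ->] := colouring_transitive cS; exists s; rewrite ?lcoset_young ?inE.
apply: orb_imset; first exact: acts_colourings.
  move=> c d /colouring_transitive[s ->] _ eq_cd.
  have : s \in coset_of_colouring [ffun x => cP (s x)].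
    by rewrite -lcoset_young lcoset_refl.
  by rewrite eq_cd => /coset_of_colouringP sd; apply/ffunP=> x; rewrite ffunE sd.
move=> c g _; apply/setP=> t; rewrite /= /lmul mem_lcoset invgK.
apply/coset_of_colouringP/coset_of_colouringP => H x.
  by rewrite permM H ffunE permK.
by rewrite [RHS]ffunE -H permM permKV.
Qed.

End YoungCosets.

Theorem theorem2 (n : nat) (hn : 2 <= n) (G : {group 'S_n})
    (la mu : seq nat) (hla : is_intpart n la) (hmu : is_intpart n mu)
    (P Q : seq {set 'I_n})
    (hP : ordered_set_partition P) (hPla : part_sizes P = la)
    (hQ : ordered_set_partition Q) (hQmu : part_sizes Q = mu) :
  dominated la mu ->
  orb (lmul_action 'S_n) G (young_cosets P) >=
  orb (lmul_action 'S_n) G (young_cosets Q).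
Proof.
move=> dom; pose N := size P + size Q.
have le_PN : size P <= N.+1 by rewrite leqW ?leq_addr.
have le_QN : size Q <= N.+1 by rewrite leqW ?leq_addl.
have size_la : size la <= N.+1 by rewrite -hPla size_map.
have size_mu : size mu <= N.+1 by rewrite -hQmu size_map.
rewrite (orb_young_cosets hP le_PN) (orb_young_cosets hQ le_QN) hPla hQmu.
case: hla hmu => sorted_la _ sum_la [_ _ sum_mu].
have sumE s : size s <= N.+1 -> \sum_(k < N.+1) nth 0 s k = sumn s.
  move=> le_sN; rewrite -[in RHS](take_oversize le_sN) -(sum_nth_take _ le_sN).
  by apply: eq_bigl => k; rewrite ltn_ord.
apply: leq_orb_dominance => [i j le_ij | m |].
- have [lt_j | /(nth_default 0)-> //] := ltnP j (size la).
  apply: (sorted_leq_nth _ _ 0 sorted_la) => //; first exact: rev_trans leq_trans.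
  - by move=> x; apply: leqnn.
  exact: leq_ltn_trans le_ij lt_j.
- by rewrite !sum_nth_take.
by rewrite !sumE // sum_la sum_mu.
Qed.
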